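(* Let $\epsilon>0$. For $q=q(n)\ge n^{2+\epsilon}$ (with $q$ a positive integer), almost every $q$-colouring of $Q_n$ is reconstructible from the multiset of its coloured $1$-balls. That is, the proportion of colourings $\chi:V(Q_n)\to\{1,\dots,q\}$ that are $1$-distinguishable tends to $1$ as $n\to\infty$.
   Context: $Q_n$ is the $n$-dimensional hypercube: vertex set $\{0,1\}^n$, two vertices adjacent iff they differ in exactly one coordinate. Colourings are vertex colourings, not necessarily proper. For a vertex $v$, $B_r(v)$ is the subgraph induced by the vertices at graph distance at most $r$ from $v$, and $\chi^{(r)}(v)=\chi|_{B_r(v)}$ is the coloured $r$-ball around $v$. Colourings $\chi$ of a graph $G$ and $\lambda$ of a graph $H$ are equivalent, $\chi\cong\lambda$, if there is a graph isomorphism $\phi:G\to H$ with $\chi=\lambda\circ\phi$. Colourings $\chi,\lambda$ of $V(Q_n)$ are $r$-locally equivalent, $\chi\cong_r\lambda$, if there is a bijection $f:V(Q_n)\to V(Q_n)$ with $\chi^{(r)}(v)\cong\lambda^{(r)}(f(v))$ for all $v$. A colouring $\chi$ is $r$-distinguishable (reconstructible from the multiset of its coloured $r$-balls) if there is no colouring $\lambda$ of $V(Q_n)$ with $\chi\cong_r\lambda$ but $\chi\not\cong\lambda$. *)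

(* Defs.v *)
From mathcomp Require Import all_boot all_order all_algebra.
From mathcomp Require Import all_classical all_reals all_analysis.

Set Implicit Arguments.
Unset Strict Implicit.
Unset Printing Implicit Defensive.

(* A graph is given by its vertex type together with its adjacency relation. *)

Definition colouring_equiv (C G H : Type) (eG : rel G) (eH : rel H)
    (chi : G -> C) (lambda : H -> C) : Prop :=
  exists phi : G -> H,
    [/\ bijective phi,
        forall x y, eH (phi x) (phi y) = eG x y &
        forall x, chi x = lambda (phi x)].

Definition dist_at_most (T : finType) (e : rel T) (r : nat) (v u : T) : Prop :=
  exists p : seq T, [/\ path e v p, last v p = u & (size p <= r)%N].

Definition graph_ball (T : finType) (e : rel T) (r : nat) (v : T) : {set T} :=
  [set u | `[< dist_at_most e r v u >]]%SET.

Definition ball_vertex (T : finType) (e : rel T) (r : nat) (v : T) : Type :=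
  {u : T | u \in graph_ball e r v}.

Definition ball_adj (T : finType) (e : rel T) (r : nat) (v : T) :
    rel (ball_vertex e r v) :=
  fun x y => e (val x) (val y).

Definition ball_colouring (C : Type) (T : finType) (e : rel T) (r : nat)
    (chi : T -> C) (v : T) : ball_vertex e r v -> C :=
  fun x => chi (val x).

(* An isomorphism of coloured balls is an arbitrary one: it is not required
   to send centre to centre. *)
Definition locally_equiv (C : Type) (T : finType) (e : rel T) (r : nat)
    (chi lambda : T -> C) : Prop :=
  exists f : T -> T,
    bijective f /\
    forall v, colouring_equiv (@ball_adj T e r v) (@ball_adj T e r (f v))
                (@ball_colouring C T e r chi v)
                (@ball_colouring C T e r lambda (f v)).

(* Letting lambda range over the colour set of chi loses nothing: a colouring
   locally equivalent to chi only uses colours of chi. *)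
Definition distinguishable (C : Type) (T : finType) (e : rel T) (r : nat)
    (chi : T -> C) : Prop :=
  ~ exists lambda : T -> C,
      locally_equiv e r chi lambda /\ ~ colouring_equiv e e chi lambda.

Definition cube (n : nat) : finType := {ffun 'I_n -> bool}.

Definition cube_adj (n : nat) : rel (cube n) :=
  fun u v => #|[set i : 'I_n | u i != v i]%SET| == 1%N.

Definition distinguishable_colourings (n q r : nat) :
    {set {ffun cube n -> 'I_q}} :=
  [set chi : {ffun cube n -> 'I_q} |
    `[< distinguishable (@cube_adj n) r chi >]]%SET.

(* Main.v *)
(* A 1-local equivalence between chi and lambda = chi o g amounts to a
   permutation g of the cube such that, for every w, the colours of g(N(w)) are
   those of N(g(w)).  We show that for almost every chi such a g is an
   automorphism.

   Put x_i = g(w + e_i).  For i <> j the colour lambda(w + e_i + e_j) occurs in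
   both N(x_i) and N(x_j).  For a given pair of disjoint neighbourhoods a common
   colour has probability about n^2 / q <= n^(-eps), so a positive proportion of
   the pairs being of this kind has probability n^(-Omega(n^2)), which beats the
   2^(n^2) choices of (x_i).  Hence almost all pairs x_i, x_j have a common
   neighbour, and then three quarters of the x_i lie in a single N(u).  If
   u <> g(w), then N(u) and N(g(w)) share linearly many colours, which has
   probability n^(-Omega(n)), again beating the 4^n choices of the two centres.
   So g preserves at least three quarters of the edges at every vertex.
   Finally, if g maps an edge {w, w'} to a non-edge, then for half of the
   directions i the colour of g(w' + e_i), a neighbour of g(w'), reappears at
   distance at most 2 from g(w), which is excluded in the same way. *)

Require Import Defs.
From mathcomp Require Import all_classical all_reals all_analysis.
From mathcomp Require Import all_boot all_order all_algebra zify.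
Import Order.TTheory GRing.Theory Num.Theory.
Import numFieldNormedType.Exports.

Set Implicit Arguments.
Unset Strict Implicit.
Unset Printing Implicit Defensive.

(** * Counting colourings with prescribed coincidences *)

(** No [z k] lies in the image of [y], so the values off that image determine the colouring, and
    injectivity of [y] leaves #|V| - #|J| free values. *)
Lemma card_collision (C V J : finType) (y z : J -> V) :
    injective y -> (forall j k, y j != z k) ->
  #|[set chi : {ffun V -> C} | [forall j, chi (y j) == chi (z j)]]| * #|C| ^ #|J|
    <= #|C| ^ #|V|.
Proof.
move=> y_inj yz; set B := [set chi | _].
pose S := [set y j | j : J].
have zS k : z k \in ~: S.
  by rewrite inE; apply/imsetP => -[j _ /eqP]; rewrite eq_sym (negPf (yz j k)).
pose res (chi : {ffun V -> C}) : {ffun {v | v \in ~: S} -> C} :=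
  [ffun v => chi (val v)].
have res_inj : {in B &, injective res}.
  move=> chi psi; rewrite !inE => /forallP chiB /forallP psiB eq_res.
  have eqC v : v \in ~: S -> chi v = psi v.
    by move=> vS; have /ffunP/(_ (exist _ v vS)) := eq_res; rewrite !ffunE.
  apply/ffunP => v; have [/imsetP[j _ ->]|vS] := boolP (v \in S).
    by rewrite (eqP (chiB j)) (eqP (psiB j)) eqC.
  by apply: eqC; rewrite inE.
rewrite -(card_in_imset res_inj).
have -> : #|V| = #|~: S| + #|J|.
  by rewrite addnC -(cardsC S) card_imset.
rewrite expnD leq_mul2r; apply/orP; right.
by apply: (leq_trans (max_card _)); rewrite card_ffun card_sig.
Qed.

Lemma card_bigcup_le (I T : finType) (P : pred I) (F : I -> {set T}) :
  #|\bigcup_(i | P i) F i| <= \sum_(i | P i) #|F i|.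
Proof.
elim/big_ind2: _ => // [|m A p B lem lep]; first by rewrite cards0.
exact: (leq_trans (leq_card_setU A B).1 (leq_add lem lep)).
Qed.

(* The slots in S carry disjoint coincidences of colours of chi; L lists the
   possible positions Y s l, Z s l of the coincidence in slot s. *)
Definition collides (C V I L : finType) (Y Z : I -> L -> V) (c m : nat)
    (chi : V -> C) : Prop :=
  exists (S : {set I}) (l : I -> L),
    [/\ m <= c * #|S|,
        {in S &, injective (fun s => Y s (l s))},
        {in S &, forall s t, Y s (l s) != Z t (l t)} &
        {in S, forall s, chi (Y s (l s)) = chi (Z s (l s))}].

(** Union bound: at most 2^#|I| sets [S], #|L|^#|S| labellings of each, and probability at most
    #|C|^(-#|S|) for each choice. The labels are paid for by (#|L| / #|C|)^#|S| <= b^(-c #|S|) <=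
    b^(-m). *)
Lemma card_collides (C V I L : finType) (Y Z : I -> L -> V) (b c m : nat)
    (B : {set {ffun V -> C}}) :
    0 < b -> b ^ c * #|L| <= #|C| -> (forall chi, chi \in B -> collides Y Z c m chi) ->
  #|B| * b ^ m <= 2 ^ #|I| * #|C| ^ #|V|.
Proof.
move=> b_gt0 le_bC Bcol.
(* Labels live on [S] only, so that they number #|L|^#|S| and not #|L|^#|I|. *)
pose E (S : {set I}) (l : {ffun {s | s \in S} -> L}) : {set {ffun V -> C}} :=
  [set chi : {ffun V -> C} |
    [&& m <= c * #|S|, injectiveb (fun s => Y (val s) (l s)),
        [forall s, forall t, Y (val s) (l s) != Z (val t) (l t)] &
        [forall s, chi (Y (val s) (l s)) == chi (Z (val s) (l s))]]].
have subB : B \subset \bigcup_(S : {set I}) \bigcup_(l : {ffun {s | s \in S} -> L}) E S l.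
  apply/subsetP => chi /Bcol[S [l [Sm Yinj YZ chiYZ]]].
  apply/bigcupP; exists S => //.
  apply/bigcupP; exists [ffun s => l (val s)] => //.
  rewrite inE Sm /=; apply/and3P; split.
  - apply/injectiveP => s t; rewrite !ffunE => eqY; apply: val_inj.
    by apply: Yinj => //; apply: valP.
  - apply/forallP => s; apply/forallP => t; rewrite !ffunE.
    by apply: YZ; apply: valP.
  - by apply/forallP => s; rewrite !ffunE; apply/eqP/chiYZ/valP.
have cardE (S : {set I}) (l : {ffun {s | s \in S} -> L}) : #|E S l| * b ^ m * #|L| ^ #|S| <= #|C| ^ #|V|.
  have [Sm|] := boolP (m <= c * #|S|); last first.
    move=> Sm; suff -> : E S l = set0 by rewrite cards0.
    by apply/setP => chi; rewrite !inE (negPf Sm).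
  have [/injectiveP Yinj|] := boolP (injectiveb (fun s => Y (val s) (l s)));
    last first.
    move=> Yinj; suff -> : E S l = set0 by rewrite cards0.
    by apply/setP => chi; rewrite !inE (negPf Yinj) andbF.
  have [/forallP YZ|] := boolP [forall s, forall t, Y (val s) (l s) != Z (val t) (l t)];
    last first.
    move=> YZ; suff -> : E S l = set0 by rewrite cards0.
    by apply/setP => chi; rewrite !inE (negPf YZ) !andbF.
  have := card_collision C Yinj (fun s => forallP (YZ s)).
  rewrite card_sig; apply: leq_trans; rewrite -mulnA.
  apply: leq_mul.
    by apply/subset_leq_card/subsetP => chi; rewrite !inE => /and4P[].
  apply: (@leq_trans (b ^ (c * #|S|) * #|L| ^ #|S|)).
    by rewrite leq_mul2r leq_pexp2l ?orbT.
  by rewrite expnM -expnMn; case: #|S| => // k; rewrite leq_exp2r.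
have sumE (S : {set I}) : \sum_(l : {ffun {s | s \in S} -> L}) #|E S l| * b ^ m <= #|C| ^ #|V|.
  have [L0|L_gt0] := posnP (#|L| ^ #|S|).
    rewrite big1 // => l _; have : 0 < #|{: {ffun {s | s \in S} -> L}}|.
      by apply/card_gt0P; exists l.
    by rewrite card_ffun card_sig L0.
  rewrite -(leq_pmul2r L_gt0) big_distrl /=.
  apply: (@leq_trans (\sum_(l : {ffun {s | s \in S} -> L}) #|C| ^ #|V|)).
    by apply: leq_sum => l _; apply: cardE.
  by rewrite sum_nat_const card_ffun card_sig mulnC.
apply: leq_trans (leq_mul (subset_leq_card subB) (leqnn _)) _.
apply: leq_trans (leq_mul (card_bigcup_le _ _) (leqnn _)) _.
rewrite big_distrl /=; apply: (@leq_trans (\sum_(S : {set I}) #|C| ^ #|V|)).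
  apply: leq_sum => S _; apply: leq_trans _ (sumE S).
  by rewrite -big_distrl leq_mul2r card_bigcup_le orbT.
have -> : 2 ^ #|I| = #|{: {set I}}| by rewrite -cardsT -card_powerset powersetT cardsT.
by rewrite sum_nat_const.
Qed.

(** * Conflict-free selection among neighbourhoods *)

(** A maximal independent subset dominates [A], so [A] is covered by #|S| sets of size at most [k];
    reflexivity covers the members of [S] themselves. *)
Lemma large_independent_set (T : finType) (A : {set T}) (r : rel T) (k : nat) :
    symmetric r -> {in A, reflexive r} ->
    {in A, forall p, #|[set p' in A | r p p']| <= k} ->
  exists2 S : {set T}, S \subset A /\ {in S &, forall p p', p != p' -> ~~ r p p'}
    & #|A| <= k * #|S|.
Proof.
move=> r_sym r_refl deg_r.
pose ind (S : {set T}) := (S \subset A) &&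
  [forall p in S, [forall p' in S, (p != p') ==> ~~ r p p']].
have ind0 : ind set0.
  by rewrite /ind sub0set /=; apply/forall_inP => p; rewrite inE.
have [S /maxsetP[/andP[SA /forall_inP Sind] Smax] _] := maxset_exists ind0.
have {}Sind : {in S &, forall p p', p != p' -> ~~ r p p'}.
  by move=> p p' pS p'S; move/forall_inP: (Sind p pS) => /(_ p' p'S) /implyP.
exists S => //; rewrite mulnC -sum_nat_const.
have subA : A \subset \bigcup_(p in S) [set p' in A | r p p'].
  apply/subsetP => p' p'A; apply/bigcupP.
  have [p'S|p'S] := boolP (p' \in S).
    by exists p' => //; rewrite inE p'A r_refl.
  have [/exists_inP[p pS rp]|] := boolP [exists p in S, r p p'].
    by exists p => //; rewrite inE p'A.
  rewrite negb_exists_in => /forall_inP nr; case/negP: p'S.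
  rewrite -(Smax (p' |: S)) ?setU11 ?subsetUr //.
  apply/andP; split; first by rewrite subUset sub1set p'A.
  apply/forall_inP => p /setU1P[->|pS]; apply/forall_inP => s /setU1P[->|sS];
    apply/implyP => ne.
  - by rewrite eqxx in ne.
  - by rewrite r_sym nr.
  - exact: nr.
  - exact: Sind.
apply: leq_trans (subset_leq_card subA) _.
apply: leq_trans (card_bigcup_le _ _) _.
by apply: leq_sum => p pS; apply/deg_r/(subsetP SA).
Qed.

(* Double count the triples of i <> j and a common neighbour of x i and x j. *)
Lemma card_heavy_incidences (I V : finType) (e : rel V) (x : I -> V) (d c : nat) :
    {in predT &, forall i j, i != j -> #|[set y | e (x i) y && e (x j) y]| <= c} ->
  #|[set p : I * V | e (x p.1) p.2 & d < #|[set j | e (x j) p.2]|]| * d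
    <= c * #|I| ^ 2.
Proof.
move=> xc.
apply: (@leq_trans (\sum_i \sum_(j | j != i) #|[set y | e (x i) y && e (x j) y]|)).
  rewrite -sum_nat_const; set A := [set p | _].
  apply: (@leq_trans (\sum_(p in A) \sum_(j | j != p.1) (e (x p.1) p.2 && e (x j) p.2))).
    apply: leq_sum => -[i y]; rewrite inE /= => /andP[iy].
    (* More than [d] indices see [y]; removing [i] itself leaves at least [d]. *)
    rewrite iy (cardsD1 i) inE iy add1n ltnS => /leq_trans; apply.
    rewrite -sum1_card big_mkcond [leqRHS]big_mkcond /=.
    by apply: leq_sum => j _; rewrite !inE; case: eqP; case: (e _ _).
  apply: (@leq_trans (\sum_p \sum_(j | j != p.1) (e (x p.1) p.2 && e (x j) p.2))).
    by rewrite big_mkcond; apply: leq_sum => p _; case: ifP.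
  rewrite -(pair_bigA _ (fun i y => \sum_(j | j != i) (e (x i) y && e (x j) y))) /=.
  apply: leq_sum => i _; rewrite exchange_big /=; apply: leq_sum => j _.
  rewrite -sum1_card [leqRHS]big_mkcond /=.
  by apply: leq_sum => y _; rewrite inE; case: (e (x i) y); case: (e (x j) y).
rewrite -mulnn mulnA [c * _]mulnC -mulnA -[leqRHS]sum_nat_const.
apply: leq_sum => i _; rewrite mulnC -sum_nat_const big_mkcond /=.
by apply: leq_sum => j _; case: ifP => // ji; apply: xc => //; rewrite eq_sym.
Qed.

(* To bound the conflicts of a pair, discard those with a i j or a j i in more
   than 160 of the neighbourhoods; at most |I|^2 / 80 incidences are that heavy.
   The rest is a greedy choice. *)
Lemma collision_matching (I V : finType) (e : rel V) (x : I -> V) (a : I -> I -> V) :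
    {in predT &, forall i j, i != j -> #|[set y | e (x i) y && e (x j) y]| <= 2} ->
    (forall i j, i != j -> e (x i) (a i j)) ->
    (forall i, {in predC1 i &, injective (a i)}) ->
    (forall i, exists y, e (x i) y) ->
    #|I| ^ 2 <= 20 * #|[set p : I * I | [forall y, ~~ (e (x p.1) y && e (x p.2) y)]]| ->
  exists S : {set I * I},
    [/\ #|I| ^ 2 <= 40 * 480 * #|S|, {in S, forall p, p.1 != p.2},
        {in S &, injective (fun p => a p.1 p.2)} &
        {in S &, forall p p', a p.1 p.2 != a p'.2 p'.1}].
Proof.
move=> xc xa a_inj x_nbr; set F := [set p | _] => leF.
have F_irr p : p \in F -> p.1 != p.2.
  case: p => i j; rewrite inE /= => /forallP nij; apply/eqP => eij.
  by have [y iy] := x_nbr i; have := nij y; rewrite -eij iy.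
pose M y := #|[set j | e (x j) y]|.
pose heavy := [set p : I * I | (p.1 != p.2) && (160 < M (a p.1 p.2))].
have le_heavy : #|heavy| * 160 <= 2 * #|I| ^ 2.
  apply: leq_trans (card_heavy_incidences 160 xc); rewrite leq_mul2r /=.
  pose h (p : I * I) := (p.1, a p.1 p.2).
  have h_inj : {in heavy &, injective h}.
    move=> [i j] [i' j']; rewrite !inE /= => /andP[ij _] /andP[ij' _] [ii aa].
    rewrite -ii in aa ij' *; congr pair.
    by apply: a_inj aa; rewrite inE eq_sym.
  rewrite -(card_in_imset h_inj).
  apply/subset_leq_card/subsetP => _ /imsetP[[i j] + ->]; rewrite !inE /=.
  by case/andP => ij aij; rewrite /= xa.
pose swap (p : I * I) := (p.2, p.1).
have swap_inj : injective swap by move=> [i j] [i' j'] [-> ->].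
pose T := [set p in F | (p \notin heavy) && (swap p \notin heavy)].
(* [F] has at least #|I|^2 / 20 pairs; heavy pairs and reversed heavy pairs remove at most #|I|^2 /
   80 each. *)
have leT : #|I| ^ 2 <= 40 * #|T|.
  have : #|F| <= #|T| + #|heavy| + #|heavy|.
    have : F \subset T :|: heavy :|: swap @^-1: heavy.
      apply/subsetP => p pF; rewrite !inE.
      move: pF; rewrite inE => ->; rewrite /=.
      by do 2!case: (_ && (160 < _)).
    move=> /subset_leq_card /leq_trans; apply.
    apply: (leq_trans (leq_card_setU _ _).1); apply: leq_add.
      exact: (leq_card_setU _ _).1.
    by rewrite -(card_imset _ swap_inj); apply/subset_leq_card/subsetP => _ /imsetP[p + ->];
      rewrite inE.
  lia.
(* The conflicts. A point arises as [a i j] from at most one pair for each [i] that sees it, so a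
   light point blocks at most 160 pairs in each role, giving degree at most 3 * 160 = 480. *)
pose r (p p' : I * I) := [|| a p.1 p.2 == a p'.1 p'.2, a p.1 p.2 == a p'.2 p'.1 |
  a p.2 p.1 == a p'.1 p'.2].
have card1 y : #|[set p : I * I | (p.1 != p.2) && (y == a p.1 p.2)]| <= M y.
  set A := [set p | _].
  have f_inj : {in A &, injective fst}.
    move=> [i j] [i' j']; rewrite !inE /= => /andP[ij /eqP aa] /andP[ij' /eqP aa'] ii.
    rewrite -ii in aa' ij' *; congr pair; apply: (a_inj i); rewrite ?inE 1?eq_sym //.
    by rewrite -aa -aa'.
  rewrite -(card_in_imset f_inj).
  apply/subset_leq_card/subsetP => _ /imsetP[[i j] + ->]; rewrite !inE /=.
  by case/andP => ij /eqP->; rewrite /= xa.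
have card2 y : #|[set p : I * I | (p.1 != p.2) && (y == a p.2 p.1)]| <= M y.
  apply: leq_trans (card1 y); rewrite -(card_imset _ swap_inj).
  apply/subset_leq_card/subsetP => _ /imsetP[[i j] + ->]; rewrite !inE /=.
  by case/andP => ij aij; rewrite /= eq_sym ij.
have [|p pT||S [ST Sind] leS] := @large_independent_set _ T r 480.
- move=> p p'; rewrite /r ![a p'.1 _ == _]eq_sym ![a p'.2 _ == _]eq_sym.
  by congr (_ || _); rewrite orbC.
- by rewrite /r eqxx.
- move=> p pT.
  have : [set p' in T | r p p'] \subset
      [set p' | (p'.1 != p'.2) && (a p.1 p.2 == a p'.1 p'.2)] :|:
      [set p' | (p'.1 != p'.2) && (a p.1 p.2 == a p'.2 p'.1)] :|:
      [set p' | (p'.1 != p'.2) && (a p.2 p.1 == a p'.1 p'.2)].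
    apply/subsetP => p'; rewrite inE => /andP[]; rewrite inE => /andP[/F_irr ne _].
    by rewrite !inE ne /= -orbA.
  move=> /subset_leq_card /leq_trans; apply.
  apply: (leq_trans (leq_card_setU _ _).1).
  have [M1 M2] : M (a p.1 p.2) <= 160 /\ M (a p.2 p.1) <= 160.
    have /F_irr ne : p \in F by move: pT; rewrite inE => /andP[].
    move: pT; rewrite inE => /and3P[_]; rewrite !inE /= [p.2 == _]eq_sym ne /=.
    by rewrite -!leqNgt.
  apply: (@leq_trans (160 + 160 + 160)) => //; apply: leq_add.
    apply: (leq_trans (leq_card_setU _ _).1).
    by apply: leq_add; apply: leq_trans M1; [apply: card1 | apply: card2].
  exact: leq_trans (card1 _) M2.
have TF : T \subset F by apply/subsetP => p; rewrite inE => /andP[].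
have SF := subsetP (subset_trans ST TF).
exists S; split=> [|p /SF/F_irr //|p p' pS p'S /= aa|p p' pS p'S].
- by apply: leq_trans leT _; rewrite -mulnA leq_mul2l leS orbT.
- apply/eqP/negPn/negP => /(Sind p p' pS p'S) /negP; apply.
  by rewrite /r aa eqxx.
(* For equal pairs the coincidence would be a common neighbour of [x p.1] and [x p.2], against
   membership in [F]. *)
- have [<-|/(Sind p p' pS p'S)] := eqVneq p p'; last by rewrite /r !negb_or => /and3P[].
  have pF := SF p pS; apply/eqP => aa.
  have := F_irr p pF; move: pF; rewrite inE => /forallP /(_ (a p.1 p.2)) + ne.
  by rewrite xa //= aa xa // eq_sym.
Qed.

(** * Geometry of the hypercube *)

Definition flip (n : nat) (i : 'I_n) (v : cube n) : cube n :=
  [ffun j => v j (+) (j == i)].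

Lemma flipK n (i : 'I_n) : involutive (flip i).
Proof. by move=> v; apply/ffunP => j; rewrite !ffunE addbK. Qed.

Lemma flipC n (i j : 'I_n) v : flip i (flip j v) = flip j (flip i v).
Proof. by apply/ffunP => k; rewrite !ffunE addbAC. Qed.

Lemma flip_inj n (v : cube n) : injective (fun i => flip i v).
Proof.
by move=> i j /ffunP/(_ i); rewrite !ffunE eqxx => /addbI/esym/eqP.
Qed.

Lemma cube_adjP n (v w : cube n) : reflect (exists i, w = flip i v) (cube_adj v w).
Proof.
apply: (iffP cards1P) => -[i].
  move=> /setP vw; exists i; apply/ffunP => j; rewrite !ffunE.
  by have := vw j; rewrite !inE => <-; case: (v j); case: (w j).
move=> ->; exists i; apply/setP => j; rewrite !inE !ffunE.
by case: (v j); case: (j == i).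
Qed.

Lemma adj_flip n (i : 'I_n) v : cube_adj v (flip i v).
Proof. by apply/cube_adjP; exists i. Qed.

Lemma cube_adj_sym n : symmetric (@cube_adj n).
Proof.
by move=> v w; apply/cube_adjP/cube_adjP => -[i ->]; exists i; rewrite flipK.
Qed.

Lemma card_cube_adj n (v : cube n) : #|[set w | cube_adj v w]| = n.
Proof.
have -> : [set w | cube_adj v w] = [set flip i v | i : 'I_n].
  apply/setP => w; rewrite inE.
  by apply/cube_adjP/imsetP => [[i ->]|[i _ ->]]; exists i.
by rewrite card_imset ?card_ord //; apply: flip_inj.
Qed.

(** The bipartition of the cube, which rules out loops and triangles. *)
Definition parity n (v : cube n) := odd #|[set i | v i]|.

Lemma parity_flip n (i : 'I_n) v : parity (flip i v) = ~~ parity v.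
Proof.
rewrite /parity (cardsD1 i) [in RHS](cardsD1 i) !inE !ffunE eqxx addbT.
have -> : [set j | flip i v j] :\ i = [set j | v j] :\ i.
  by apply/setP => j; rewrite !inE !ffunE; case: (j == i); rewrite ?addbF.
by case: (v i); rewrite ?negbK.
Qed.

Lemma cube_adj_triangle n (u v w : cube n) :
  cube_adj u v -> cube_adj u w -> ~~ cube_adj v w.
Proof.
move=> /cube_adjP[i ->] /cube_adjP[j ->]; apply/cube_adjP => -[k /(congr1 (@parity n))].
by rewrite !parity_flip; case: (parity u).
Qed.

Lemma cube_adj_irr n (v : cube n) : cube_adj v v = false.
Proof.
by apply/cube_adjP => -[i /(congr1 (@parity n))]; rewrite parity_flip; case: (parity v).
Qed.

Lemma flip2_eq n (a b i j : 'I_n) (v : cube n) :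
  a != b -> flip a (flip b v) = flip i (flip j v) -> i \in [:: a; b].
Proof.
move=> ab /ffunP eq_v; have := eq_v a; have := eq_v b; rewrite !ffunE !inE.
rewrite !eqxx (negPf ab) [b == a]eq_sym (negPf ab).
do 2![case: (v _)]; rewrite /= [a == i]eq_sym [b == i]eq_sym;
  have [ai|_] := eqVneq i a; have [bi|_] := eqVneq i b => //=;
  have [aj|_] := eqVneq a j; have [bj|_] := eqVneq b j => //=;
  by move: ab; rewrite aj bj eqxx.
Qed.

(** A common neighbour forces v = u + e_a + e_b with a <> b, and then only u + e_a and u + e_b are
    adjacent to both. *)
Lemma card_common_nbrs n (u v : cube n) :
  u != v -> #|[set y | cube_adj u y && cube_adj v y]| <= 2.
Proof.
move=> uv; have [->|[y0]] := set_0Vmem [set y | cube_adj u y && cube_adj v y].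
  by rewrite cards0.
rewrite inE => /andP[/cube_adjP[a ->]]; rewrite cube_adj_sym => /cube_adjP[b def_v].
have ab : b != a by apply: contraNneq uv => eq_ab; rewrite def_v eq_ab flipK.
apply: leq_trans (_ : #|[set flip a u; flip b u]| <= 2); last by rewrite cards2; case: eqP.
apply/subset_leq_card/subsetP => y; rewrite !inE => /andP[/cube_adjP[i ->]].
rewrite cube_adj_sym => /cube_adjP[j]; rewrite def_v [RHS]flipC => /(flip2_eq ab).
by rewrite !inE => /orP[]/eqP->; rewrite eqxx ?orbT.
Qed.

(** For n > 0 this means distance 0 or 2. *)
Definition share_nbr n (x y : cube n) := [exists z, cube_adj x z && cube_adj y z].

Lemma share_nbrP n (x y : cube n) :
  reflect (exists i j, y = flip j (flip i x)) (share_nbr x y).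
Proof.
apply: (iffP existsP) => [[z /andP[/cube_adjP[i ->]]]|[i [j ->]]].
  by rewrite cube_adj_sym => /cube_adjP[j ->]; exists i, j.
by exists (flip i x); rewrite adj_flip cube_adj_sym adj_flip.
Qed.

Lemma share_nbr_sym n : symmetric (@share_nbr n).
Proof. by move=> x y; apply: eq_existsb => z; rewrite andbC. Qed.

(** If such a vertex exists, y = u + e_i + e_j + e_k. For i' outside {i, j, k}, [y] agrees with [u]
    at i', so two steps from [flip i' u] to [y] must undo i', which would make [y] adjacent to
    [u]. *)
Lemma card_nbrs_share n (u y : cube n) :
  ~~ cube_adj u y -> #|[set x | cube_adj u x && share_nbr x y]| <= 3.
Proof.
move=> uy; have [->|[x0]] := set_0Vmem [set x | cube_adj u x && share_nbr x y].
  by rewrite cards0.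
rewrite inE => /andP[/cube_adjP[i ->] /share_nbrP[j [k def_y]]].
apply: leq_trans (_ : #|[set flip i u; flip j u; flip k u]| <= 3); last first.
  by rewrite -setUA cardsU1 cards2; do 2!case: (_ \notin _) || case: (_ != _).
apply/subset_leq_card/subsetP => x; rewrite !inE => /andP[/cube_adjP[i']].
move=> -> {x} /share_nbrP[j' [k' def_y']].
suff : i' \in [:: i; j; k].
  by rewrite !inE => /or3P[]/eqP->; rewrite eqxx ?orbT.
apply: contraNT uy; rewrite !inE !negb_or => /and3P[i'i i'j i'k].
have := congr1 (fun f : cube n => f i') def_y.
rewrite /= def_y' !ffunE (negPf i'i) (negPf i'j) (negPf i'k) eqxx !addbF.
have [<-|_] := eqVneq i' j'; first by rewrite flipK adj_flip.
have [<-|_] := eqVneq i' k'; first by rewrite flipC flipK adj_flip.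
by case: (u i').
Qed.

(* x + y and x + z are 2-sets, and they meet: otherwise y + z would be a 4-set. *)
Lemma share_nbr_two_stars n (x y : cube n) :
    x != y -> share_nbr x y ->
  exists u u', forall z, z != x -> z != y -> share_nbr x z -> share_nbr y z ->
    cube_adj u z || cube_adj u' z.
Proof.
move=> xy /share_nbrP[a [b def_y]].
have ab : a != b by apply: contraNneq xy => eq_ab; rewrite def_y eq_ab flipK.
exists (flip a x), (flip b x) => z zx zy /share_nbrP[c [d def_z]].
have cd : c != d by apply: contraNneq zx => eq_cd; rewrite def_z eq_cd flipK.
move=> /share_nbrP[e [f def_z']].
have [->|ca] := eqVneq a c; first by rewrite def_z adj_flip.
have [->|cb] := eqVneq b c; first by rewrite def_z adj_flip orbT.
have [->|da] := eqVneq a d; first by rewrite def_z flipC adj_flip.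
have [->|db] := eqVneq b d; first by rewrite def_z flipC adj_flip orbT.
have /ffunP eq_z : flip d (flip c x) = flip f (flip e y) by rewrite -def_z.
have ef i : i \in [:: a; b; c; d] -> i = e \/ i = f.
  have [->|ie] := eqVneq i e; first by left.
  have [->|if_] := eqVneq i f; first by right.
  have := eq_z i; rewrite def_y !ffunE (negPf ie) (negPf if_) !addbF !inE.
  have [->|ia] := eqVneq i a.
    by rewrite (negPf ca) (negPf da) (negPf ab); case: (x a).
  have [->|ib] := eqVneq i b.
    by rewrite (negPf cb) (negPf db); case: (x b).
  have [->|ic] := eqVneq i c.
    by rewrite (negPf cd); case: (x c).
  by have [->|id] := eqVneq i d; case: (x _).
have [] : [/\ a = e \/ a = f, b = e \/ b = f & c = e \/ c = f].
  by split; apply: ef; rewrite !inE eqxx ?orbT.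
by move: ab ca cb => /eqP + /eqP + /eqP; intuition congruence.
Qed.

(** Two indices that share a neighbour and are far from few others put almost all points in two
    stars. A point of the smaller star off the larger one is far from all but three points of the
    larger, so a larger star below 3n/4 would create too many far pairs. *)
Lemma dense_share_star n (x : 'I_n -> cube n) :
    200 <= n -> injective x ->
    20 * #|[set p : 'I_n * 'I_n |
             [forall y, ~~ (cube_adj (x p.1) y && cube_adj (x p.2) y)]]| < n ^ 2 ->
  exists u, 3 * n <= 4 * #|[set i | cube_adj u (x i)]|.
Proof.
move=> n200 x_inj; pose far i j := ~~ share_nbr (x i) (x j).
pose f i := #|[set j | far i j]|.
have -> : #|[set p : 'I_n * 'I_n |
    [forall y, ~~ (cube_adj (x p.1) y && cube_adj (x p.2) y)]]| = \sum_i f i.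
  rewrite /f; under [RHS]eq_bigr do rewrite -sum1_card.
  rewrite pair_big_dep -sum1_card; apply: eq_bigl => -[i j] /=.
  by rewrite !inE /far negb_exists.
set h := \sum_i f i => lt_h.
have sum_le (A : {set 'I_n}) d : {in A, forall i, d <= f i} -> #|A| * d <= h.
  move=> Ad; rewrite -sum_nat_const /h big_mkcond /=.
  by apply: leq_sum => i _; case: ifP => // /Ad.
have [i lt_fi] : exists i, 20 * f i < n.
  apply/existsP; apply: contraLR lt_h; rewrite negb_exists -leqNgt => /forallP fn.
  rewrite /h big_distrr /= -mulnn -[n in n * _]card_ord -sum_nat_const.
  by apply: leq_sum => i _; rewrite leqNgt fn.
(* At least 9n/10 indices share a neighbour with [i]; if each were far from more than n/18 indices,
   the total would reach n^2 / 20. *)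
have [j [ij sij lt_fj]] : exists j, [/\ j != i, share_nbr (x i) (x j) & 18 * f j <= n].
  pose J := [set j | (j != i) && share_nbr (x i) (x j)].
  have cJ : n <= #|J| + f i + 1.
    rewrite -[n in n <= _]card_ord -cardsT -(cards1 i).
    have : setT \subset J :|: [set j | far i j] :|: [set i].
      by apply/subsetP => j _; rewrite !inE /far; case: (j == i); case: share_nbr.
    move=> /subset_leq_card /leq_trans; apply.
    apply: (leq_trans (leq_card_setU _ _).1); rewrite leq_add2r.
    exact: (leq_card_setU _ _).1.
  have [/exists_inP[j]|] := boolP [exists j in J, 18 * f j <= n].
    by rewrite inE => /andP[ji sij] fj; exists j.
  rewrite negb_exists_in => /forall_inP fJ.
  have : #|J| * (n %/ 18).+1 <= h.
    by apply: sum_le => j /fJ; rewrite -ltnNge; lia.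
  have : 20 * #|J| * n <= 360 * (#|J| * (n %/ 18).+1).
    rewrite -[360]/(20 * 18) -!mulnA leq_mul2l /= mulnCA leq_mul2l; apply/orP; right; lia.
  have : 18 * n * n <= 20 * #|J| * n by rewrite leq_mul2r; apply/orP; right; lia.
  move: lt_h; rewrite -mulnn -mulnA; lia.
have xij : x i != x j by apply: contraNneq ij => /x_inj ->.
have [u [u' uu']] := share_nbr_two_stars xij sij.
pose A v := [set k | cube_adj v (x k)].
have cA : n <= #|A u :|: A u'| + f i + f j + 2.
  rewrite -[n in n <= _]card_ord -cardsT.
  have : setT \subset A u :|: A u' :|: [set k | far i k] :|: [set k | far j k] :|: [set i; j].
    apply/subsetP => k _; rewrite !inE /far.
    have [->|ki] := eqVneq k i; first by rewrite !orbT.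
    have [->|kj] := eqVneq k j; first by rewrite !orbT.
    have [sik|] := boolP (share_nbr (x i) (x k)); last by rewrite !orbT.
    have [sjk|] := boolP (share_nbr (x j) (x k)); last by rewrite !orbT.
    by rewrite uu' // inj_eq.
  move=> /subset_leq_card /leq_trans; apply.
  apply: (leq_trans (leq_card_setU _ _).1); apply: leq_add; last first.
    by rewrite cards2; case: eqP.
  apply: (leq_trans (leq_card_setU _ _).1); rewrite leq_add2r.
  exact: (leq_card_setU _ _).1.
have key v v' : #|A v'| <= #|A v| -> n <= #|A v :|: A v'| + f i + f j + 2 ->
    3 * n <= 4 * #|A v|.
  move=> le_A cAA.
  have cU : #|A v :|: A v'| = #|A v| + #|A v' :\: A v|.
    by have := subset_leq_card (subsetIl (A v') (A v)); rewrite cardsU cardsD setIC; lia.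
  have : #|A v' :\: A v| * (#|A v| - 3) <= h.
    apply: sum_le => k; rewrite !inE => /andP[vk _].
    have := card_nbrs_share vk.
    have : A v \subset [set l | cube_adj v (x l) && share_nbr (x l) (x k)] :|:
        [set l | far k l].
      by apply/subsetP => l; rewrite !inE /far share_nbr_sym => ->; case: share_nbr.
    move=> /subset_leq_card /leq_trans /(_ (leq_card_setU _ _).1).
    have -> : #|[set l | cube_adj v (x l) && share_nbr (x l) (x k)]| =
        #|x @: [set l | cube_adj v (x l) && share_nbr (x l) (x k)]|.
      by rewrite card_imset.
    have : x @: [set l | cube_adj v (x l) && share_nbr (x l) (x k)] \subset
        [set y | cube_adj v y && share_nbr y (x k)].
      by apply/subsetP => _ /imsetP[l + ->]; rewrite !inE.
    move=> /subset_leq_card; rewrite -/(f k); lia.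
  have : #|A v' :\: A v| <= #|A v'| by rewrite subset_leq_card ?subsetDl.
  rewrite leqNgt => le_B le_h; apply/negP => lt_A.
  (* The union has at least n - n/20 - n/18 - 2 points, half of them in the larger star; the
     contradiction is 0.13 * 0.42 > 1/20. *)
  have lb1 : 13 * n <= 100 * #|A v' :\: A v| by lia.
  have lb2 : 42 * n <= 100 * (#|A v| - 3) by lia.
  have := leq_mul lb1 lb2; rewrite mulnACA [leqRHS]mulnACA.
  move: lt_h; rewrite -mulnn; lia.
have [le_A|/ltnW le_A] := leqP #|A u'| #|A u|.
  by exists u; apply: key le_A cA.
by exists u'; apply: key le_A _; rewrite setUC.
Qed.

(** * Exceptional events and rigidity *)

(* beta w i is the neighbour of g w that the isomorphism between the coloured
   1-balls at g w and w matches with the i-th neighbour of w. *)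
Definition compatible (C : Type) n (chi : cube n -> C) (g : cube n -> cube n) : Prop :=
  injective g /\
  exists beta : cube n -> 'I_n -> cube n, forall w, injective (beta w) /\
    forall i, cube_adj (g w) (beta w i) /\ chi (beta w i) = chi (g (flip i w)).

(** [x] stands for the images under [g] of the neighbours of one vertex. A slot is a pair of
    indices; its label gives the directions from the two images to the equally coloured vertices. *)
Definition pair_event (C : finType) n c (x : {ffun 'I_n -> cube n}) (chi : cube n -> C) :=
  @collides C (cube n) ('I_n * 'I_n)%type ('I_n * 'I_n)%type
    (fun s l => flip l.1 (x s.1)) (fun s l => flip l.2 (x s.2)) c (n ^ 2) chi.

(** Slots are the neighbours of [vw.2]; the label says where around [vw.1] the colour recurs. *)
Definition nbr_event (C : finType) n c (vw : cube n * cube n) (chi : cube n -> C) :=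
  @collides C (cube n) 'I_n 'I_n
    (fun i _ => flip i vw.2) (fun _ l => flip l vw.1) c n chi.

Definition second_nbr_event (C : finType) n c (vw : cube n * cube n) (chi : cube n -> C) :=
  @collides C (cube n) 'I_n ('I_n * 'I_n)%type
    (fun i _ => flip i vw.2) (fun _ l => flip l.2 (flip l.1 vw.1)) c n chi.

(** The at most three neighbours of [w] that are themselves some [Z l] are dropped from [Q], since
    [collides] wants the two sides of the coincidences disjoint. *)
Lemma collides_nbrs (C L : finType) n c (chi : cube n -> C) (Z : L -> cube n)
    (w : cube n) (Q : {set cube n}) :
    ('I_n -> L) -> n <= c * (#|Q| - 3) ->
    {in Q, forall x, cube_adj w x /\ exists l, chi x = chi (Z l)} ->
    #|[set x | cube_adj w x && [exists l, x == Z l]]| <= 3 ->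
  @collides C (cube n) 'I_n L (fun i _ => flip i w) (fun _ l => Z l) c n chi.
Proof.
move=> l0 le_n Qchi cardT; set T := [set x | _] in cardT.
pose S := [set i | flip i w \in Q :\: T].
have [i|l chi_l] := @fin_all_exists _ _
    (fun i l => i \in S -> chi (flip i w) = chi (Z l)).
  (* [l0] supplies an arbitrary label off [S]. *)
  have [|iS] := boolP (i \in S); last by exists (l0 i).
  by rewrite !inE => /andP[_ /Qchi[_ [l ->]]]; exists l.
exists S, l; split=> [|i j _ _ /flip_inj //|i j|i /chi_l //].
  apply: leq_trans le_n _; rewrite leq_mul2l leq_subLR; apply/orP; right.
  rewrite -(card_imset _ (@flip_inj _ w)).
  have : Q \subset T :|: [set flip i w | i in S].
    apply/subsetP => x xQ; rewrite !inE; have [/cube_adjP[i def_x] _] := Qchi x xQ.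
    case xT : (_ && _) => //=; apply/imsetP; exists i => //.
    by rewrite !inE -def_x xT.
  move=> /subset_leq_card /leq_trans; apply.
  apply: (leq_trans (leq_card_setU _ _).1); exact: leq_add.
move=> + _; rewrite !inE adj_flip /= => /andP[+ _]; apply: contraNneq => ->.
by apply/existsP; exists (l j).
Qed.

Section Rigidity.
Variables (C : finType) (n c : nat) (chi : cube n -> C) (g : cube n -> cube n).
Hypotheses (n200 : 200 <= n) (le_c : 40 * 480 <= c) (chi_g : compatible chi g).
Hypotheses (no_pair : forall x, ~ pair_event c x chi)
  (no_nbr : forall vw, ~ nbr_event c vw chi)
  (no_nbr2 : forall vw, ~ second_nbr_event c vw chi).

Lemma image_in_star w : exists u, 3 * n <= 4 * #|[set i | cube_adj u (g (flip i w))]|.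
Proof.
have [g_inj [beta betaP]] := chi_g.
pose x i := g (flip i w).
have x_inj : injective x by move=> i j /g_inj /flip_inj.
have [|far_le] := ltnP (20 * #|[set p : 'I_n * 'I_n |
    [forall y, ~~ (cube_adj (x p.1) y && cube_adj (x p.2) y)]]|) (n ^ 2).
  by apply: dense_share_star n200 x_inj.
(* Both [a i j] and [a j i] carry the colour of [g (flip i (flip j w))]. *)
pose a i j := beta (flip i w) j.
have xa i j : cube_adj (x i) (a i j) by have [_ /(_ j)[]] := betaP (flip i w).
have chi_a i j : chi (a i j) = chi (a j i).
  have [_ /(_ j)[_ chi_i]] := betaP (flip i w).
  by have [_ /(_ i)[_ chi_j]] := betaP (flip j w); rewrite /a chi_i chi_j flipC.
have [|//|i j j' _ _ aa|i||S [leS S_irr a_inj a_disj]] :=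
    @collision_matching _ _ (@cube_adj n) x a.
- by move=> i j _ _ ij; apply: card_common_nbrs; rewrite inj_eq.
- by have [inj _] := betaP (flip i w); apply: inj aa.
- by exists (a i i); apply: xa.
- by rewrite card_ord.
have [p|l lP] := @fin_all_exists _ _ (fun (p l : 'I_n * 'I_n) =>
    flip l.1 (x p.1) = a p.1 p.2 /\ flip l.2 (x p.2) = a p.2 p.1).
  have /cube_adjP[d ->] := xa p.1 p.2; have /cube_adjP[d' ->] := xa p.2 p.1.
  by exists (d, d').
case: (no_pair (x := finfun x)); exists S, l; split.
- move: leS; rewrite card_ord => /leq_trans; apply.
  by rewrite leq_mul2r le_c orbT.
- by move=> p p' pS p'S; rewrite !ffunE !(lP _).1; apply: a_inj.
- by move=> p p' pS p'S; rewrite !ffunE (lP _).1 (lP _).2; apply: a_disj.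
- by move=> p pS; rewrite !ffunE (lP _).1 (lP _).2.
Qed.

Lemma most_edges_preserved w :
  3 * n <= 4 * #|[set i | cube_adj (g w) (g (flip i w))]|.
Proof.
have [g_inj [beta betaP]] := chi_g.
have [u le_u] := image_in_star w; suff -> : g w = u by [].
(* Otherwise [beta w i], a neighbour of [g w], repeats the colour of [g (flip i w)], a neighbour of
   [u], for at least 3n/4 directions. *)
apply/eqP/negPn/negP => neq_u; case: (no_nbr (vw := (u, g w))).
pose A := [set i | cube_adj u (g (flip i w))].
apply: (collides_nbrs (Q := [set beta w i | i in A])) => //=.
- rewrite card_imset; last by have [] := betaP w.
  apply: (@leq_trans (2 * (#|A| - 3))); first by move: le_u; rewrite -/A; lia.
  by rewrite leq_mul2r (leq_trans _ le_c) ?orbT.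
- move=> _ /imsetP[i + ->]; rewrite inE => /cube_adjP[l def_gi].
  have [_ /(_ i)[-> ->]] := betaP w.
  by split=> //; exists l; rewrite def_gi.
- apply: leq_trans (_ : 2 <= 3) => //; apply: leq_trans (card_common_nbrs neq_u).
  apply/subset_leq_card/subsetP => y; rewrite !inE => /andP[-> /existsP[l /eqP->]].
  exact: adj_flip.
Qed.

(** At least half of the directions [i] keep their edge at both [w] and y = flip e w. For these,
    [beta (flip i w) e] has the colour of [g (flip i y)] and is reached from [g w] in two steps. *)
Lemma edges_preserved w y : cube_adj w y -> cube_adj (g w) (g y).
Proof.
have [g_inj [beta betaP]] := chi_g.
move=> /cube_adjP[e def_y]; apply/negPn/negP => nadj.
case: (no_nbr2 (vw := (g w, g y))).
pose A v := [set i | cube_adj (g v) (g (flip i v))].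
have le_A v : 3 * n <= 4 * #|A v| by apply: most_edges_preserved.
apply: (collides_nbrs (Q := [set g (flip i y) | i in A w :&: A y])) => //=.
- rewrite card_imset; last by move=> i j /g_inj /flip_inj.
  apply: (@leq_trans (4 * (#|A w :&: A y| - 3))); last first.
    by rewrite leq_mul2r (leq_trans _ le_c) ?orbT.
  have := max_card (mem (A w :|: A y)); rewrite cardsU card_ord.
  have := le_A w; have := le_A y; lia.
- move=> _ /imsetP[i + ->]; rewrite !inE => /andP[/cube_adjP[l1 def_wi] ->].
  split=> //; have [_ /(_ e)[]] := betaP (flip i w).
  by rewrite def_wi => /cube_adjP[l2 ->] eq_chi; exists (l1, l2); rewrite eq_chi def_y flipC.
(* As [g y] and [g w] are not adjacent, at most three neighbours of [g y] are two steps from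
   [g w]. *)
- have : ~~ cube_adj (g y) (g w) by rewrite cube_adj_sym.
  move/card_nbrs_share; apply: leq_trans.
  apply/subset_leq_card/subsetP => x; rewrite !inE => /andP[-> /existsP[l /eqP->]].
  by rewrite share_nbr_sym; apply/share_nbrP; exists l.1, l.2.
Qed.

End Rigidity.

(** * From local equivalence to compatible permutations *)

(** All neighbourhoods have n elements, so [g] maps each one onto the neighbourhood of the image;
    hence non-edges are preserved too. *)
Lemma cube_adj_morph n (g : cube n -> cube n) :
    injective g -> (forall v w, cube_adj v w -> cube_adj (g v) (g w)) ->
  forall v w, cube_adj (g v) (g w) = cube_adj v w.
Proof.
move=> g_inj g_adj v w; have g_im : g @: [set y | cube_adj v y] = [set y | cube_adj (g v) y].
  apply/eqP; rewrite eqEcard card_imset // !card_cube_adj leqnn andbT.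
  by apply/subsetP => _ /imsetP[y + ->]; rewrite !inE => /g_adj.
have := mem_imset [set y | cube_adj v y] w g_inj.
by rewrite g_im !inE.
Qed.

Lemma mem_ball1 n (v u : cube n) :
  (u \in graph_ball (@cube_adj n) 1 v) = (u == v) || cube_adj v u.
Proof.
rewrite inE; apply/asboolP/orP => [[p [+ <- +]]|[/eqP->|vu]].
- by case: p => [|w [|//]] /=; [left | rewrite andbT; right].
- by exists [::].
- by exists [:: u]; rewrite /= vu.
Qed.

Lemma locally_equiv_compatible (C : Type) n (chi lambda : cube n -> C) :
    1 < n -> locally_equiv (@cube_adj n) 1 chi lambda ->
  exists f g, [/\ cancel f g, cancel g f, forall v, chi v = lambda (f v) &
                  compatible chi g].
Proof.
move=> n_gt1 [f [[g fK gK] f_ball]]; exists f, g.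
have centre v : exists beta : 'I_n -> cube n,
    [/\ chi v = lambda (f v), injective beta &
        forall i, cube_adj v (beta i) /\ chi (beta i) = lambda (flip i (f v))].
  have [phi [[psi phiK psiK] phi_adj phi_chi]] := f_ball v.
  have vB : v \in graph_ball (@cube_adj n) 1 v by rewrite mem_ball1 eqxx.
  have fvB : f v \in graph_ball (@cube_adj n) 1 (f v) by rewrite mem_ball1 eqxx.
  have nB i : flip i (f v) \in graph_ball (@cube_adj n) 1 (f v).
    by rewrite mem_ball1 adj_flip orbT.
  pose v0 : ball_vertex (@cube_adj n) 1 v := exist _ v vB.
  pose w0 : ball_vertex (@cube_adj n) 1 (f v) := exist _ (f v) fvB.
  pose nbr i : ball_vertex (@cube_adj n) 1 (f v) := 
    exist (fun u => u \in graph_ball (@cube_adj n) 1 (f v)) _ (nB i).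
  have v0_adj x : x != v0 -> cube_adj v (val x).
    move=> xv; have := valP x; rewrite mem_ball1 => /predU1P[ex|//].
    by case/eqP: xv; apply: val_inj.
  (* A ball isomorphism must fix the centre: [v0] is adjacent to the rest of its ball, whereas for n
     > 1 a neighbour of [f v] is not adjacent to another one, by triangle-freeness. *)
  have phi_v0 : phi v0 = w0.
    apply/eqP/negPn/negP => ne.
    have : cube_adj (f v) (val (phi v0)).
      have := valP (phi v0); rewrite mem_ball1 => /predU1P[ex|//].
      by case/eqP: ne; apply: val_inj.
    move=> /[dup] adj_c /cube_adjP[i def_c].
    have [j ji] : exists j : 'I_n, j != i.
      apply/existsP; rewrite -[[exists _, _]]negbK negb_exists; apply/negP => /forallP all_i.
      have : #|'I_n| <= #|[set i]|.
        by apply/subset_leq_card/subsetP => j _; rewrite inE; have := all_i j; rewrite negbK.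
      by rewrite card_ord cards1 leqNgt n_gt1.
    have ne_psi : psi (nbr j) != v0.
      apply: contra_neq ji => e_psi; apply: (@flip_inj _ (f v)).
      by rewrite /= -def_c -e_psi psiK.
    have := v0_adj _ ne_psi; have := phi_adj v0 (psi (nbr j)).
    rewrite /ball_adj psiK /= => <-.
    by apply/negP; apply: cube_adj_triangle adj_c (adj_flip j (f v)).
  exists (fun i => val (psi (nbr i))); split=> [|i j /val_inj /(can_inj psiK)|i].
  - by have := phi_chi v0; rewrite phi_v0.
  - by case=> /flip_inj.
  - split; last by have := phi_chi (psi (nbr i)); rewrite psiK.
    have := phi_adj v0 (psi (nbr i)); rewrite psiK phi_v0 /ball_adj /= => <-.
    exact: adj_flip.
have [beta betaP] := fin_all_exists centre.
split=> // [v|]; first by have [] := betaP v.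
split; first exact: can_inj gK.
(* Taken at v = g w, where the second ball is centred at f (g w) = w. *)
exists (fun w => beta (g w)) => w; have [_ inj adj] := betaP (g w).
split=> // i; have [-> ->] := adj i; split=> //.
have [-> _ _] := betaP (g (flip i w)); by rewrite !gK.
Qed.

(** * Counting the exceptional colourings *)

Lemma card_union_events (T U : finType) (B : {set U}) (ev : T -> U -> Prop) (b k : nat) :
    (forall t (B' : {set U}), {in B', forall x, ev t x} -> #|B'| * b <= k) ->
    {in B, forall x, exists t, ev t x} ->
  #|B| * b <= #|T| * k.
Proof.
move=> le_k Bev; pose E t := [set x | `[< ev t x >]].
have : B \subset \bigcup_t E t.
  apply/subsetP => x /Bev[t tx]; apply/bigcupP; exists t => //.
  by rewrite inE; apply/asboolP.
move=> /subset_leq_card /leq_trans /(_ (card_bigcup_le _ _)) le_B.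
apply: leq_trans (leq_mul le_B (leqnn b)) _; rewrite big_distrl /= -sum_nat_const.
by apply: leq_sum => t _; apply: (le_k t) => x; rewrite inE => /asboolP.
Qed.

(** With b = 16, the pair events have 2^(n^2) choices of [x] and 2^(n^2) slot sets against 16^(n^2);
    each of the other two kinds has 4^n choices of centres and 2^n slot sets against 16^n. Each kind
    thus has proportion at most 2^(-n). *)
Lemma card_nondistinguishable n q c :
    200 <= n -> 40 * 480 <= c -> 16 ^ c * n ^ 2 <= q ->
  #|~: distinguishable_colourings n q 1| * 2 ^ n <= 3 * q ^ (2 ^ n).
Proof.
move=> n200 le_c le_q; set B := ~: _.
pose ev1 (x : {ffun 'I_n -> cube n}) (chi : {ffun cube n -> 'I_q}) := pair_event c x chi.
pose ev2 vw (chi : {ffun cube n -> 'I_q}) := nbr_event c vw chi.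
pose ev3 vw (chi : {ffun cube n -> 'I_q}) := second_nbr_event c vw chi.
pose B1 : {set {ffun cube n -> 'I_q}} := [set chi | `[< exists x, ev1 x chi >]].
pose B2 : {set {ffun cube n -> 'I_q}} := [set chi | `[< exists vw, ev2 vw chi >]].
pose B3 : {set {ffun cube n -> 'I_q}} := [set chi | `[< exists vw, ev3 vw chi >]].
have cardV : #|cube n| = 2 ^ n by rewrite card_ffun card_bool card_ord.
have subB : B \subset B1 :|: B2 :|: B3.
  apply/subsetP => chi; rewrite inE => chiB; rewrite !in_setU.
  have [c1|n1] := pselect (exists x, ev1 x chi).
    by rewrite [chi \in B1]inE asboolT.
  have [c2|n2] := pselect (exists vw, ev2 vw chi).
    by rewrite [chi \in B2]inE (asboolT c2) orbT.
  have [c3|n3] := pselect (exists vw, ev3 vw chi).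
    by rewrite [chi \in B3]inE (asboolT c3) orbT.
  apply: contraNT chiB => _; rewrite inE; apply/asboolP => -[lambda [eq_loc]]; apply.
  have [|f [g [fK gK chi_f chi_g]]] := locally_equiv_compatible _ eq_loc.
    exact: leq_trans n200.
  have g_adj : forall v w, cube_adj v w -> cube_adj (g v) (g w).
    apply: (edges_preserved n200 le_c chi_g) => [x|vw|vw] ev.
    - by apply: n1; exists x.
    - by apply: n2; exists vw.
    - by apply: n3; exists vw.
  exists f; split=> // [|x y]; first by exists g.
  by rewrite -(cube_adj_morph (can_inj gK) g_adj) !fK.
have le_qn : 16 ^ c * n <= q.
  by apply: leq_trans le_q; rewrite leq_mul2l -mulnn leq_pmull ?orbT //; lia.
have card1 : #|B1| * 16 ^ (n ^ 2) <= #|{: {ffun 'I_n -> cube n}}| * (2 ^ (n ^ 2) * q ^ (2 ^ n)).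
  apply: (card_union_events (ev := ev1)) => [x B' ev|chi]; last by rewrite inE => /asboolP.
  apply: leq_trans (card_collides _ _ ev) _ => //.
    by rewrite card_prod !card_ord.
  by rewrite card_prod !card_ord cardV mulnn.
have card2 : #|B2| * 16 ^ n <= #|{: cube n * cube n}| * (2 ^ n * q ^ (2 ^ n)).
  apply: (card_union_events (ev := ev2)) => [x B' ev|chi]; last by rewrite inE => /asboolP.
  apply: leq_trans (card_collides _ _ ev) _ => //.
    by rewrite !card_ord.
  by rewrite !card_ord cardV.
have card3 : #|B3| * 16 ^ n <= #|{: cube n * cube n}| * (2 ^ n * q ^ (2 ^ n)).
  apply: (card_union_events (ev := ev3)) => [x B' ev|chi]; last by rewrite inE => /asboolP.
  apply: leq_trans (card_collides _ _ ev) _ => //.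
    by rewrite card_prod !card_ord.
  by rewrite !card_ord cardV.
move: (q ^ (2 ^ n)) card1 card2 card3 => Q.
rewrite card_ffun card_prod cardV card_ord -expnM mulnn => card1 card2 card3.
have le1 : #|B1| * 2 ^ n <= Q.
  apply: (@leq_trans (#|B1| * 4 ^ (n ^ 2))).
    rewrite leq_mul2l -[4]/(2 ^ 2) -expnM leq_pexp2l ?orbT //.
    by rewrite -mulnn; nia.
  have pos : 0 < 2 ^ (n ^ 2) * 2 ^ (n ^ 2) by rewrite muln_gt0 expn_gt0.
  rewrite -(leq_pmul2r pos) [leqRHS]mulnC -[leqRHS]mulnA; apply: leq_trans card1.
  by rewrite -mulnA -!expnMn.
have le2 (B' : {set {ffun cube n -> 'I_q}}) :
    #|B'| * 16 ^ n <= 2 ^ n * 2 ^ n * (2 ^ n * Q) -> #|B'| * 2 ^ n <= Q.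
  have pos : 0 < 2 ^ n * 2 ^ n * 2 ^ n by rewrite !muln_gt0 expn_gt0.
  rewrite mulnA => le_B'; rewrite -(leq_pmul2r pos) [leqRHS]mulnC.
  apply: leq_trans le_B'.
  by rewrite -mulnA -!expnMn.
have := subset_leq_card subB.
have := (leq_card_setU (B1 :|: B2) B3).1; have := (leq_card_setU B1 B2).1.
move=> leU leU' leB.
apply: leq_trans (leq_mul (leq_trans leB (leq_trans leU' (leq_add leU (leqnn _)))) (leqnn _)) _.
rewrite !mulnDl (_ : 3 * Q = Q + Q + Q); last by lia.
by rewrite !leq_add ?le1 ?le2.
Qed.

(** * Passage to the limit *)

Local Open Scope classical_set_scope.
Local Open Scope ring_scope.

(** Since n^(2 + eps) = n^2 n^eps, it suffices that n >= A^(1 / eps). *)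
Lemma powR_eventually_dominates (R : realType) (eps : R) (q : nat -> nat) (A : nat) :
    0 < eps -> (forall n, (n%:R : R) `^ (2 + eps) <= (q n)%:R) ->
  \forall n \near \oo, (A * n ^ 2 <= q n)%N.
Proof.
move=> eps_gt0 le_q; near=> n.
have n_gt0 : (0 < n)%N by near: n; exists 1%N.
have n_gt0R : 0 < n%:R :> R by rewrite ltr0n.
rewrite -(ler_nat R); apply: le_trans (le_q n).
rewrite powRD ?(gt_eqF n_gt0R) ?implybT // natrM natrX powR_mulrn ?ler0n // mulrC.
rewrite ler_wpM2l ?exprn_ge0 ?ler0n //.
have -> : A%:R = (A%:R `^ eps^-1) `^ eps :> R.
  by rewrite -powRrM mulVf ?gt_eqF // powRr1 ?ler0n.
have le_n : A%:R `^ eps^-1 <= n%:R :> R by near: n; apply: nbhs_infty_ger.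
by apply: ge0_ler_powR le_n; rewrite ?nnegrE ?powR_ge0 ?ler0n // ltW.
Unshelve. all: by end_near. Qed.

Theorem theorem1p2 (R : realType) (eps : R) (heps : 0 < eps)
  (q : nat -> nat) (hq0 : forall n : nat, (0 < q n)%N)
  (hq : forall n : nat, (n%:R : R) `^ (2 + eps) <= (q n)%:R) :
  (fun n : nat =>
     (#|distinguishable_colourings n (q n) 1|%:R
      / #|{: {ffun cube n -> 'I_(q n)}}|%:R : R)) @ \oo --> (1 : R).
Proof.
(* The value comes from the matching, which has at least n^2 / (40 * 480) pairs; hiding it keeps
   16^c symbolic. *)
pose c := (40 * 480)%N; have le_c : (40 * 480 <= c)%N by apply: leqnn.
clearbody c.
(* The lower bound of the squeeze: the exceptional proportion is eventually at most 3 / 2^n. *)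
have lim : (fun n => 1 - 3 * (2^-1 : R) ^+ n) @ \oo --> (1 : R).
  rewrite -[X in _ --> X]subr0 -[X in _ --> _ - X](mulr0 (3 : R)).
  apply: cvgB; first exact: cvg_cst.
  apply: cvgM; first exact: cvg_cst.
  by apply: cvg_expr; rewrite ger0_norm ?invr_ge0 ?ler0n // invf_lt1 ?ltr1n.
apply: squeeze_cvgr lim (cvg_cst (1 : R)).
have le_q := powR_eventually_dominates (16 ^ c) heps hq.
near=> n; set D := distinguishable_colourings n (q n) 1.
have cardT : #|{: {ffun cube n -> 'I_(q n)}}| = (q n ^ (2 ^ n))%N.
  by rewrite !card_ffun card_bool !card_ord.
have Q_gt0 : 0 < (q n ^ (2 ^ n))%N%:R :> R by rewrite ltr0n expn_gt0 hq0.
rewrite cardT ler_pdivrMr // ler_pdivlMr // mul1r ler_nat -cardT max_card andbT.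
have card_co : (#|~: D| * 2 ^ n <= 3 * q n ^ (2 ^ n))%N.
  apply: (card_nondistinguishable _ le_c); first by near: n; exists 200%N.
  by near: n.
have := cardsC D; rewrite cardT => /(congr1 (fun k => k%:R : R)).
rewrite natrD => /(canRL (addrK _)) ->; rewrite mulrBl mul1r lerD2l lerN2.
rewrite exprVn mulrAC ler_pdivlMr ?exprn_gt0 ?ltr0n //.
by rewrite -natrX -!natrM ler_nat.
Unshelve. all: by end_near. Qed.
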